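(* Let $P$ be an arbitrary partially ordered set, let $P^*$ be its dual and $P^{**}$ its second dual. Then the partially ordered sets $P$ and $P^{**}$ are isomorphic.
   Context: $\mathbf{2}=\{0,1\}$ is the two-element partially ordered set with $0<1$. The dual $P^*$ is the set of all monotone mappings $x:P\to\mathbf{2}$ (i.e. $p\le q$ implies $x(p)\le x(q)$), with the pointwise order: $x\le y$ iff $x(p)\le y(p)$ for all $p\in P$. $P^*$ is a complete lattice; its universal bounds are the constant mappings $\mathbf{0}$ (with $\mathbf{0}(p)=0$ for all $p$) and $\mathbf{1}$ (with $\mathbf{1}(p)=1$ for all $p$). The second dual $P^{**}$ is the set of all homomorphisms of complete lattices $P^*\to\mathbf{2}$ preserving universal bounds, that is, all mappings $f:P^*\to\mathbf{2}$ such that for every subset $K\subseteq P^*$ one has $f(\sup K)=\sup_{k\in K}f(k)$ and $f(\inf K)=\inf_{k\in K}f(k)$, and such that $f(\mathbf{0})=0$ and $f(\mathbf{1})=1$. $P^{**}$ is ordered pointwise: $f\le g$ iff $f(x)\le g(x)$ for all $x\in P^*$. An isomorphism of partially ordered sets is an order-preserving bijection whose inverse is also order-preserving. *)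

(* Defs.v *)
From HB Require Import structures.
From mathcomp Require Import all_boot all_order.
From mathcomp Require Import boolp classical_sets.

Set Implicit Arguments.
Unset Strict Implicit.
Unset Printing Implicit Defensive.

Import Order.TTheory.

Local Open Scope classical_set_scope.
Local Open Scope order_scope.

(* The two-element poset 2 is [bool] with its library order, false < true.    *)
(* Both duals are subtypes of a function type and inherit from it the         *)
(* pointwise order of boolp (characterized by lefP).                          *)

Section PosetDual.
Context {d : Order.disp_t} (P : porderType d).

Definition dual_pred : pred (P -> bool) :=
  fun x => `[< {homo x : p q / p <= q} >].

Record poset_dual := PosetDual {
  dual_fun :> P -> bool;
  dual_funP : dual_pred dual_fun }.

HB.instance Definition _ := [isSub for dual_fun].
HB.instance Definition _ := [Choice of poset_dual by <:].
HB.instance Definition _ :=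
  [SubChoice_isSubPOrder of poset_dual by <: with FunOrder.fun_display].

Lemma poset_dual_leP (x y : poset_dual) :
  reflect (forall p, x p <= y p) (x <= y).
Proof. exact: lefP. Qed.

Lemma dual_pred_cst (b : bool) : dual_pred (fun=> b).
Proof. exact/asboolP. Qed.

Definition dual_cst (b : bool) : poset_dual := PosetDual (dual_pred_cst b).

Lemma dual_cst_false_le (x : poset_dual) : dual_cst false <= x.
Proof. exact/poset_dual_leP. Qed.

Lemma dual_cst_true_ge (x : poset_dual) : x <= dual_cst true.
Proof. by apply/poset_dual_leP => p; case: (x p). Qed.

HB.instance Definition _ :=
  @Order.hasBottom.Build _ poset_dual (dual_cst false) dual_cst_false_le.
HB.instance Definition _ :=
  @Order.hasTop.Build _ poset_dual (dual_cst true) dual_cst_true_ge.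

End PosetDual.

(* [supremum x0 K] and [infimum x0 K] return x0 on the empty set, so the      *)
(* default has to be \bot, resp. \top, to obtain the lattice sup and inf.     *)
Definition complete_morphism {d d'} {L : tbPOrderType d} {M : tbPOrderType d'}
    (f : L -> M) : Prop :=
  (forall K : set L, f (supremum \bot K) = supremum \bot (f @` K)) /\
  (forall K : set L, f (infimum \top K) = infimum \top (f @` K)).

Section PosetBidual.
Context {d : Order.disp_t} (P : porderType d).

Definition bidual_pred : pred (poset_dual P -> bool) :=
  fun f => `[< [/\ complete_morphism f, f \bot = false & f \top = true] >].

Record poset_bidual := PosetBidual {
  bidual_fun :> poset_dual P -> bool;
  bidual_funP : bidual_pred bidual_fun }.

HB.instance Definition _ := [isSub for bidual_fun].
HB.instance Definition _ := [Choice of poset_bidual by <:].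
HB.instance Definition _ :=
  [SubChoice_isSubPOrder of poset_bidual by <: with FunOrder.fun_display].

Lemma poset_bidual_leP (f g : poset_bidual) :
  reflect (forall x, f x <= g x) (f <= g).
Proof. exact: lefP. Qed.

End PosetBidual.

Definition poset_isomorphic {d d'} (P : porderType d) (Q : porderType d') :=
  exists f : P -> Q, exists g : Q -> P,
    [/\ cancel f g, cancel g f,
        {homo f : p q / p <= q} & {homo g : p q / p <= q}].

(* On the two complete lattices in play, the total operations above are       *)
(* genuine least upper and greatest lower bounds, computed pointwise.         *)

Lemma supremum_botE d (L : tbPOrderType d) (K : set L) (s : L) :
  supremums K s -> supremum \bot K = s.
Proof.
move=> Ks; rewrite /supremum; case: ifPn => [/eqP K0|_].
  by apply/eqP; rewrite eq_le le0x; apply: Ks.2 => x; rewrite K0.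
case: xgetP => [y _ Ky|/(_ s)//]; exact: is_subset1_supremums Ky Ks.
Qed.

Lemma infimum_topE d (L : tbPOrderType d) (K : set L) (s : L) :
  infimums K s -> infimum \top K = s.
Proof.
move=> Ks; rewrite /infimum; case: ifPn => [/eqP K0|_].
  by apply/eqP; rewrite eq_le lex1 andbT; apply: Ks.2 => x; rewrite K0.
case: xgetP => [y _ Ky|/(_ s)//]; exact: is_subset1_infimums Ky Ks.
Qed.

Lemma bool_supremumsP (K : set bool) : supremums K `[< K true >].
Proof.
split=> [b Kb|b /(_ true) ubb]; first by case: b Kb => // /asboolT ->.
by case: asboolP => [/ubb|_]; [case: b ubb|case: b ubb].
Qed.

Lemma bool_infimumsP (K : set bool) : infimums K `[< ~ K false >].
Proof.
split=> [b Kb|b /(_ false) lbb].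
  by case: b Kb => [_|K0]; [case: asbool|case: asboolP].
by case: asboolP => [_|/contrapT/lbb]; case: b lbb.
Qed.

Lemma poset_dual_supremumsP d (P : porderType d) (K : set (poset_dual P)) :
  supremums K (supremum \bot K) /\
  forall p, supremum \bot K p = supremum \bot [set x p | x in K].
Proof.
have sP : dual_pred (fun p => `[< exists2 x, K x & x p >]).
  apply/asboolP => p q pq; case: asboolP => // -[x Kx xp].
  case: asboolP => // -[]; exists x => //.
  by have /asboolP/(_ _ _ pq) := dual_funP x; rewrite xp; case: (x q).
have Ks : supremums K (PosetDual sP).
  split=> [x Kx|y uby]; apply/poset_dual_leP => p /=.
    case xp : (x p) => //; case: asboolP => // -[]; by exists x.
  case: asboolP => // -[x Kx xp].
  by have /poset_dual_leP/(_ p) := uby x Kx; rewrite xp.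
rewrite (supremum_botE Ks); split=> // p /=.
by rewrite (supremum_botE (bool_supremumsP _)); apply: asbool_equiv_eq.
Qed.

Lemma poset_dual_infimumsP d (P : porderType d) (K : set (poset_dual P)) :
  infimums K (infimum \top K) /\
  forall p, infimum \top K p = infimum \top [set x p | x in K].
Proof.
have sP : dual_pred (fun p => `[< forall x, K x -> x p >]).
  apply/asboolP => p q pq; case: asboolP => // Kp.
  case: asboolP => // -[] x Kx.
  by have /asboolP/(_ _ _ pq) := dual_funP x; rewrite Kp //; case: (x q).
have Ks : infimums K (PosetDual sP).
  split=> [x Kx|y lby]; apply/poset_dual_leP => p /=.
    by case: asboolP => // /(_ x Kx) ->.
  case yp : (y p) => //; case: asboolP => // -[] x Kx.
  by have /poset_dual_leP/(_ p) := lby x Kx; rewrite yp; case: (x p).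
rewrite (infimum_topE Ks); split=> // p /=.
rewrite (infimum_topE (bool_infimumsP _)); apply: asbool_equiv_eq.
split=> [Kp [x /Kp] -> //|Kp x Kx]; case xp : (x p) => //.
by case: Kp; exists x.
Qed.

(* Main.v *)
Require Import Defs.
From mathcomp Require Import all_boot all_order.
From mathcomp Require Import boolp classical_sets.

(** Elements of the dual are up-sets of [P], with suprema and infima given by
    union and intersection, so evaluation at a point [p] is a point of the
    second dual; it is monotone in [p], and it reflects the order because the
    principal up-set of [p] separates [p] from every [q] that is not above it.

    The content is that every [f] in the second dual is such an evaluation
    ([bidual_eval_surj]).  Every up-set is the union of the principal up-sets
    of its members; as [f] preserves suprema, [f x] holds iff [x] has a member
    [q] whose principal up-set is accepted by [f] ([bidual_principalP]).  As [f]
    preserves infima, it accepts the intersection [m] of all up-sets that it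
    accepts, so [m] has a member [p] with accepted principal up-set.  This [p]
    represents [f]: an accepted [x] contains [m], hence [p], and conversely an
    [x] that contains [p] is accepted by the criterion above. *)

Set Implicit Arguments.
Unset Strict Implicit.
Unset Printing Implicit Defensive.

Import Order.TTheory.

Local Open Scope classical_set_scope.
Local Open Scope order_scope.

Lemma complete_morphism_supE d (L : tbPOrderType d) (f : L -> bool)
    (K : set L) :
  complete_morphism f -> f (supremum \bot K) = `[< exists2 x, K x & f x >].
Proof.
by case=> fsup _; rewrite fsup (supremum_botE (bool_supremumsP _)).
Qed.

Lemma complete_morphism_infE d (L : tbPOrderType d) (f : L -> bool)
    (K : set L) :
  complete_morphism f -> f (infimum \top K) = `[< forall x, K x -> f x >].
Proof.
case=> _ finf; rewrite finf (infimum_topE (bool_infimumsP _)).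
apply: asbool_equiv_eq; split=> [nKf x Kx|Kf [x /Kf fx]]; last by rewrite fx.
by case fx : (f x) => //; case: nKf; exists x.
Qed.

Section Evaluation.
Context {d : Order.disp_t} (P : porderType d).
Implicit Types (p q : P) (x : poset_dual P) (f : poset_bidual P).

Lemma poset_dual_homo x : {homo x : p q / p <= q}.
Proof. exact/asboolP/dual_funP. Qed.

Lemma poset_bidual_complete f : complete_morphism f.
Proof. by have /asboolP[] := bidual_funP f. Qed.

Lemma principal_subproof p : dual_pred (fun q => p <= q).
Proof.
apply/asboolP => q r qr; case pq : (p <= q) => //.
by rewrite (le_trans pq qr).
Qed.

Definition principal p : poset_dual P := PosetDual (principal_subproof p).

Lemma principal_leE p x : (principal p <= x) = x p.
Proof.
apply/poset_dual_leP/idP => [/(_ p)|xp q]; first by rewrite /= lexx; case: (x p).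
rewrite /=; case pq : (p <= q) => //.
by have := poset_dual_homo x pq; rewrite xp.
Qed.

Lemma supremum_principal x :
  supremum \bot (principal @` [set p | x p]) = x.
Proof.
apply: supremum_botE; split=> [_ [p xp <-]|y uby]; first by rewrite principal_leE.
apply/poset_dual_leP => p; case xp : (x p) => //.
have : principal p <= y by apply: uby; exists p.
by rewrite principal_leE => ->.
Qed.

(** Suprema and infima in the dual are pointwise, so evaluation at a
    point preserves them. *)
Lemma bidual_eval_subproof p : bidual_pred (fun x => x p).
Proof.
apply/asboolP; split=> //; split=> K.
  by have [_ ->] := poset_dual_supremumsP K.
by have [_ ->] := poset_dual_infimumsP K.
Qed.

Definition bidual_eval p : poset_bidual P :=
  PosetBidual (bidual_eval_subproof p).

(** The principal up-set of [p], which contains [p], contains [q] as well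
    as soon as evaluation at [q] dominates evaluation at [p]. *)
Lemma bidual_eval_leE p q : (bidual_eval p <= bidual_eval q) = (p <= q).
Proof.
apply/poset_bidual_leP/idP => [/(_ (principal p))|pq x] /=.
  by rewrite lexx; case: (p <= q).
exact: poset_dual_homo.
Qed.

Lemma bidual_eval_inj : injective bidual_eval.
Proof.
by move=> p q pq; apply/le_anti; rewrite -!bidual_eval_leE pq lexx.
Qed.

(** An element of the second dual is determined by its values on principal
    up-sets, since these generate the dual under suprema. *)
Lemma bidual_principalP f x :
  reflect (exists2 p, x p & f (principal p)) (f x).
Proof.
rewrite -[in f x](supremum_principal x).
rewrite complete_morphism_supE; last exact: poset_bidual_complete.
apply: (iffP (asboolP _)) => [[_ [p xp <-] fp]|[p xp fp]]; first by exists p.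
by exists (principal p) => //; exists p.
Qed.

Lemma bidual_infimum f : f (infimum \top [set x | f x]).
Proof.
rewrite complete_morphism_infE; last exact: poset_bidual_complete.
exact/asboolP.
Qed.

Lemma bidual_eval_surj f : exists p, bidual_eval p = f.
Proof.
have /bidual_principalP[p mp fp] := bidual_infimum f.
exists p; apply/val_inj/funext => x /=; apply/idP/idP => [xp|fx].
  by apply/bidual_principalP; exists p.
(* [p] lies in the least accepted up-set, hence in the accepted [x]. *)
have [[lbm _] _] := poset_dual_infimumsP [set x | f x].
by have /poset_dual_leP/(_ p) := lbm x fx; rewrite mp; case: (x p).
Qed.

End Evaluation.

Theorem lemma5 (d : Order.disp_t) (P : porderType d) :
  poset_isomorphic P (poset_bidual P).
Proof.
have [g gK] := choice (@bidual_eval_surj d P).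
exists (@bidual_eval d P), g; split=> // [p|p q|f h fh].
- exact: (bidual_eval_inj (gK _)).
- by rewrite bidual_eval_leE.
- by rewrite -bidual_eval_leE !gK.
Qed.
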